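(* For every integer $k \ge 4$, $\gamma(k) \le (2k-2)\,\gamma(k-1) + 6$.
   Context: For words $C,S$, $C$ is an \emph{s-cover} (subsequence cover) of $S$ if for every position $i$ of $S$ there exist indices $j_0<j_1<\dots<j_{|C|-1}$ with $S[j_t]=C[t]$ for all $t$ and $i\in\{j_0,\dots,j_{|C|-1}\}$ (i.e., every position of $S$ lies in some occurrence of $C$ as a subsequence). An s-cover $C$ of $S$ is \emph{non-trivial} if $|C|<|S|$. A word is \emph{s-primitive} if it has no non-trivial s-cover. $\gamma(k)$ denotes the maximum length of an s-primitive word over an alphabet of size $k$ (this maximum is finite). *)

(* Defs.v *)
From mathcomp Require Import all_boot.
From Stdlib Require Import ClassicalEpsilon.
Set Implicit Arguments. Unset Strict Implicit. Unset Printing Implicit Defensive.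

(* C is an s-cover of S: every position i of S lies in some occurrence of C
   as a subsequence of S; an occurrence is a selection mask m (the positions
   j_0 < ... < j_{|C|-1} are the indices where m is true). *)
Definition s_cover (T : eqType) (C S : seq T) : Prop :=
  forall i, i < size S ->
    exists m : bitseq, [/\ size m = size S, mask m S = C & nth false m i].

Definition s_primitive (T : eqType) (S : seq T) : Prop :=
  ~ (exists C : seq T, s_cover C S /\ size C < size S).

Definition gamma_spec (k g : nat) : Prop :=
  (exists S : seq 'I_k, s_primitive S /\ size S = g) /\
  (forall S : seq 'I_k, s_primitive S -> size S <= g).

(* gamma k := that maximum (it exists and is finite; default 0 is never used). *)
Definition gamma (k : nat) : nat :=
  match excluded_middle_informative (exists g, gamma_spec k g) with
  | left H => proj1_sig (constructive_indefinite_description _ H)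
  | right _ => 0
  end.

(* Main.v *)
Require Import Defs.
From mathcomp Require Import all_boot.
From mathcomp Require Import zify.
From Stdlib Require Import ClassicalEpsilon.
Set Implicit Arguments. Unset Strict Implicit. Unset Printing Implicit Defensive.

(** Factors of an s-primitive word S are s-primitive, so every factor of S that
    misses a letter has length at most g = gamma (k - 1); hence from any position
    each other letter recurs within g steps.  For a factor T of S containing all
    letters, let p (resp. q) list the letters by first (resp. last) occurrence.
    The word p q, with the middle letter shared when p ends with the first letter
    of q, is a candidate s-cover of T.  A position holding the letter a is covered
    through the a of p as soon as the letters after a in p embed before the last
    occurrence of the head of q, and each of these letters costs at most g steps;
    the a of q gives the symmetric condition.  If a is not too close to both ends
    of p q, one of the two conditions holds as soon as |T| >= (2k - 2) g.
    The exceptional letters are excluded by a condition on the two letters at each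
    end of T, which square-freeness of S makes attainable after deleting at most
    six letters from the ends of S. *)

(** * s-covers, factors and squares of s-primitive words *)

Section Covers.
Variable T : eqType.
Implicit Types (C S s w X Y : seq T) (a b c d : T).

(** Local form of [s_cover] at the displayed [a], free of masks and stable under reversal. *)
Definition covers_at C S1 a S2 :=
  exists C1 C2, [/\ C = C1 ++ a :: C2, subseq C1 S1 & subseq C2 S2].

Lemma s_coverP C S :
  (forall S1 a S2, S = S1 ++ a :: S2 -> covers_at C S1 a S2) -> s_cover C S.
Proof.
move=> HC i ltiS; have [x0 _]: exists x0 : T, True by case: S ltiS {HC} => // x; exists x.
have eS : S = take i S ++ nth x0 S i :: drop i.+1 S by rewrite -drop_nth // cat_take_drop.
have [C1 [C2 [-> /subseqP[m1 sz1 ->] /subseqP[m2 sz2 ->]]]] := HC _ _ _ eS.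
have sz1i : size m1 = i by rewrite sz1 size_take ltiS.
exists (m1 ++ true :: m2); split.
- by rewrite [in RHS]eS !size_cat /= sz1 sz2.
- by rewrite [in LHS]eS mask_cat.
- by rewrite nth_cat sz1i ltnn subnn.
Qed.

Lemma covers_at_rev C S1 a S2 :
  covers_at (rev C) (rev S2) a (rev S1) -> covers_at C S1 a S2.
Proof.
move=> [C1 [C2 [eC sub1 sub2]]]; exists (rev C2), (rev C1); split.
- by rewrite -(revK C) eC rev_cat rev_cons cat_rcons.
- by rewrite -subseq_rev revK.
- by rewrite -subseq_rev revK.
Qed.

(** A shorter s-cover [C] of [S] would give the shorter s-cover [X ++ C ++ Y] of the whole word. *)
Lemma s_primitive_factor X S Y : s_primitive (X ++ S ++ Y) -> s_primitive S.
Proof.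
move=> prim [C [covC ltCS]]; apply: prim; exists (X ++ C ++ Y).
split; last by rewrite !size_cat; lia.
move=> i ltiS.
have [m [szm eC covi]] : exists m : bitseq, [/\ size m = size S, mask m S = C
    & size X <= i < size X + size S -> nth false m (i - size X)].
  have [/andP[leXi ltiX]|_] := boolP (size X <= i < size X + size S).
    have [|m [szm eC mi]] := covC (i - size X); first by lia.
    by exists m.
  (* For a position in [X] or [Y] any occurrence of [C] in [S] will do; [S] is nonempty because [C]
     is shorter. *)
  by have [|m [szm eC _]] := covC 0; [lia | exists m].
exists (nseq (size X) true ++ m ++ nseq (size Y) true); split.
- by rewrite !size_cat !size_nseq szm.
- by rewrite !mask_cat ?size_nseq // !mask_true // eC.
- rewrite nth_cat size_nseq; case: ltnP => [ltiX|leXi]; first by rewrite nth_nseq ltiX.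
  rewrite nth_cat szm; case: ltnP => [lt|le]; first by apply: covi; lia.
  by move: ltiS; rewrite nth_nseq !size_cat => ltiS; case: ltnP => //; lia.
Qed.

Lemma s_primitive_nil : s_primitive ([::] : seq T).
Proof. by move=> [C [_]]. Qed.

(** A nonempty [S] is an s-cover of [S ++ S], occurring as either half. *)
Lemma s_primitive_squarefree X S Y : s_primitive (X ++ (S ++ S) ++ Y) -> S = [::].
Proof.
case: S => // a S /s_primitive_factor prim; case: prim; exists (a :: S).
split; last by rewrite size_cat /=; lia.
move=> i; rewrite size_cat => lti; set s := a :: S in lti *.
have szn (b : bool) : size (nseq (size s) b) = size s by rewrite size_nseq.
have [ltis|leis] := ltnP i (size s).
- exists (nseq (size s) true ++ nseq (size s) false); split.
  + by rewrite size_cat !szn.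
  + by rewrite mask_cat // mask_true // mask_false cats0.
  + by rewrite nth_cat szn ltis nth_nseq ltis.
- exists (nseq (size s) false ++ nseq (size s) true); split.
  + by rewrite size_cat !szn.
  + by rewrite mask_cat // mask_true // mask_false.
  + by rewrite nth_cat szn ifN -?leqNgt // nth_nseq ifT //; lia.
Qed.

Lemma s_primitive_nth_square z s i l : s_primitive s -> 0 < l -> i + 2 * l <= size s ->
  ~ (forall t, t < l -> nth z s (i + t) = nth z s (i + l + t)).
Proof.
move=> prim l0 szs eqs.
have szl m : m + l <= size s -> size (take l (drop m s)) = l.
  by move=> le; rewrite size_takel // size_drop; lia.
have e : take l (drop i s) = take l (drop (i + l) s).
  apply: (@eq_from_nth _ z); rewrite !szl; try lia.
  by move=> t ltt; rewrite !nth_take // !nth_drop eqs.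
have es : s = take i s ++ (take l (drop i s) ++ take l (drop i s)) ++ drop l (drop (i + l) s).
  by rewrite {2}e -catA cat_take_drop addnC -drop_drop !cat_take_drop.
have := prim; rewrite es => /s_primitive_squarefree /(congr1 size).
by rewrite szl /=; lia.
Qed.

(** * Letters ordered by first or last occurrence *)

(* MathComp's [undup] keeps the last occurrence of each letter. *)
Lemma undup_split s S1 a S2 Q1 Q2 :
  s = S1 ++ a :: S2 -> undup s = Q1 ++ a :: Q2 -> subseq Q2 S2.
Proof.
move=> ->; elim: S1 Q1 => [|x S1 IH] Q1 /=.
- case: ifPn => [_ eS2|aS2].
    apply: subseq_trans (undup_subseq S2); rewrite eS2 -cat_rcons.
    exact: suffix_subseq.
  case: Q1 => [|y Q1] [].
    by move=> <-; rewrite undup_subseq.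
  by move=> _ eS2; move: aS2; rewrite -mem_undup eS2 mem_cat mem_head orbT.
- case: ifPn => [_ /IH //|xS]; case: Q1 => [|y Q1] [ex eS]; last exact: IH eS.
  by move: xS; rewrite ex mem_cat mem_head orbT.
Qed.

(** [d] is the letter whose last occurrence comes earliest; [s] is cut there. *)
Lemma undup_consP s d q : undup s = d :: q ->
  exists F G, [/\ s = F ++ d :: G, undup G = q & d \notin G].
Proof.
elim: s => //= x s IH; case: ifPn => [_ /IH[F [G [-> eG dG]]]|xs [<- <-]].
- by exists (x :: F), G.
- by exists [::], s.
Qed.

Definition firsts s := rev (undup (rev s)).

Lemma firsts_split s S1 a S2 P1 P2 :
  s = S1 ++ a :: S2 -> firsts s = P1 ++ a :: P2 -> subseq P1 S1.
Proof.
move=> es ep; rewrite -subseq_rev.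
apply: (@undup_split (rev s) (rev S2) a _ (rev P2)).
- by rewrite es rev_cat rev_cons cat_rcons.
- by rewrite -[LHS]revK -/(firsts s) ep rev_cat rev_cons cat_rcons.
Qed.

(** Two distinct final letters are both last occurrences, so [undup] ends with them. *)
Lemma undup_end s x y Q1 a Q2 : x != y ->
  undup (s ++ [:: x; y]) = Q1 ++ a :: Q2 ->
  (size Q2 = 0 -> a = y) /\ (size Q2 = 1 -> a = x).
Proof.
move=> neq; rewrite undup_cat /= inE (negbTE neq).
case: Q2 => [|b [|b' Q2]] e; split=> // _.
- by move: e => /(congr1 rev); rewrite !rev_cat /= => -[].
- by move: e => /(congr1 rev); rewrite !rev_cat /= => -[].
Qed.


(** * Greedy embedding in words where every letter recurs quickly *)

Lemma uniq_path_neq a w : uniq (a :: w) -> path (fun x y => x != y) a w.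
Proof.
elim: w a => //= b w IH a /andP[]; rewrite inE negb_or => /andP[-> _] /=.
exact: IH.
Qed.

Definition dense g s :=
  forall A B D b, s = A ++ B ++ D -> b \notin B -> size B <= g.

Lemma dense_rev g s : dense g s -> dense g (rev s).
Proof.
move=> Hs A B D b es bB; rewrite -size_rev.
apply: (Hs (rev D) (rev B) (rev A) b); last by rewrite mem_rev.
by rewrite -(revK s) es !rev_cat catA.
Qed.

(** A window of [g + 1] letters starting at [a] contains every letter, so the next [b], differing
    from [a], lies within [g] steps; then iterate. *)
Lemma dense_chain g A a R w : dense g (A ++ a :: R) ->
  path (fun x y => x != y) a w -> size w * g <= size R ->
  subseq w (take (size w * g) R).
Proof.
elim: w A a R => [|b w IH] A a R Hs; first by rewrite sub0seq.
move=> /= /andP[ab pw]; rewrite mulSn => szR.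
have bR : b \in take g R.
  apply: contraT => bR.
  have /(Hs A _ (drop g R) b) : A ++ a :: R = A ++ (a :: take g R) ++ drop g R.
    by rewrite /= cat_take_drop.
  rewrite inE negb_or eq_sym ab bR /= size_take_min => /(_ isT); lia.
have [R1 [R2 [eR szR1]]] : exists R1 R2, R = R1 ++ b :: R2 /\ size R1 < g.
  have : size (take g R) <= g by rewrite size_take_min; lia.
  case/splitPr: bR {IH} (cat_take_drop g R) => R1 R2 <-; rewrite size_cat /= => szR12.
  by exists R1, (R2 ++ drop g R); rewrite -catA; split=> //; lia.
have szR2 : size w * g <= size R2 by move: szR; rewrite eR size_cat /=; lia.
have := IH (A ++ a :: R1) b R2; rewrite -catA /= -eR => /(_ Hs pw szR2) subw.
rewrite eR take_cat ifF; last by lia.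
have [m ->] : exists m, g + size w * g - size R1 = (size w * g + m).+1.
  by exists (g - (size R1).+1); lia.
rewrite /= takeD -[b :: w]cat0s cat_subseq ?sub0seq //= eqxx.
by apply: subseq_trans subw _; exact: prefix_subseq.
Qed.

(** [P1] embeds before [a] by first occurrences, [P2] by [dense_chain] between [a] and the [d]
    following [F], and [v] after that [d]. *)
Lemma covers_left g s S1 a S2 P1 P2 Z F d G v : 0 < g -> dense g s ->
  s = S1 ++ a :: S2 -> firsts s = P1 ++ a :: P2 ++ Z ->
  s = F ++ d :: G -> subseq v G -> last a P2 != d ->
  size S1 + size P2 * g <= size F ->
  covers_at (P1 ++ a :: P2 ++ d :: v) S1 a S2.
Proof.
move=> g0 Hs es ep eF subv lastd room.
exists P1, (P2 ++ d :: v); split=> //; first exact: firsts_split es ep.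
have pP2 : path (fun x y => x != y) a P2.
  apply: uniq_path_neq; have : uniq (firsts s) by rewrite rev_uniq undup_uniq.
  by rewrite ep -cat_cons catA cat_uniq cat_uniq => /andP[/and3P[]].
have [F2 eF2 eS2] : exists2 F2, F = S1 ++ a :: F2 & S2 = F2 ++ d :: G.
  have szS1 : size S1 <= size F by lia.
  have : S1 ++ a :: S2 = take (size S1) F ++ drop (size S1) F ++ d :: G.
    by rewrite catA cat_take_drop -es.
  move/eqP; rewrite eqseq_cat ?size_takel // => /andP[/eqP e1].
  case eD: (drop _ F) => [|a' F2] /=; rewrite eqseq_cons => /andP[/eqP ea /eqP e2].
    (* If [F = S1], the room condition makes [P2] empty, and [a = d] contradicts [lastd]. *)
    have szF : size F = size S1 by move: (congr1 size eD); rewrite size_drop /=; lia.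
    case: (P2) room lastd => [|b P2'] /=; first by rewrite ea eqxx.
    by rewrite szF; nia.
  by exists F2 => //; rewrite ea -eD {1}e1 cat_take_drop.
rewrite {}eS2 in es *.
apply: cat_subseq; last by rewrite /= eqxx.
have szP2 : size P2 * g <= (size F2).+1 by move: room; rewrite eF2 size_cat /=; lia.
(* [F2] may be one letter too short for the chain, so [d] is added; since [P2] does not end in [d],
   it embeds in [F2] alone. *)
have : subseq P2 (rcons F2 d).
  have := @dense_chain g S1 a (F2 ++ d :: G) P2; rewrite -es => /(_ Hs pP2).
  rewrite size_cat /= -cat_rcons => sub; apply: subseq_trans (sub _) _; first by lia.
  rewrite takel_cat ?size_rcons //; exact: take_subseq.
case/lastP: (P2) lastd => [|P3 b]; first by move=> *; exact: sub0seq.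
rewrite last_rcons => bd; rewrite -subseq_rev !rev_rcons /= (negbTE bd).
by rewrite -rev_rcons subseq_rev.
Qed.
End Covers.

(** * Counting, and the choice of letters to delete at the ends *)

(** Adding the two failed room conditions gives [n < g1 + g2 + (A + B) * g]: the tails account for
    [2 * g], the chains for [(2 * k - 4) * g]. *)
Lemma no_room k g n A B s1 s2 f1 f2 g1 g2 : 2 <= k ->
  n = s1 + s2.+1 -> n = f1 + g1.+1 -> n = f2 + g2.+1 ->
  g1 <= g -> g2 <= g -> f1 < s1 + A * g -> f2 < s2 + B * g ->
  A + B <= 2 * k - 4 -> n < (2 * k - 2) * g.
Proof. by move=> *; nia. Qed.
(** [x] reads a word from the left and [y] from the right; [i] and [j] count deleted letters. If
    every pair is bad, [x] follows a few transitions among [y 0], [y 1], [y 2], and excluding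
    squares of period up to 3 leaves one prefix. *)
Lemma good_ends (T : eqType) (x y : nat -> T) :
  (forall i, i < 6 -> x i != x i.+1) ->
  (forall i, i < 4 -> x i = x i.+2 -> x i.+1 = x i.+3 -> False) ->
  (forall i, i < 2 -> x i = x i.+3 -> x i.+1 = x i.+4 -> x i.+2 = x i.+4.+1 -> False) ->
  (forall j, j < 3 -> y j != y j.+1) ->
  exists i j, [/\ i + j <= 6, x i != y j, x i != y j.+1 & x i.+1 != y j].
Proof.
move=> sq1 sq2 sq3 sqy.
have [/existsP[i /existsP[j /and4P[]]]|] :=
  boolP [exists i : 'I_7, exists j : 'I_7,
    [&& i + j <= 6, x i != y j, x i != y j.+1 & x i.+1 != y j]].
  by exists i, j.
rewrite negb_exists => /forallP noij.
have bad i j : i + j <= 6 -> [|| x i == y j, x i == y j.+1 | x i.+1 == y j].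
  move=> leij; have lti : i < 7 by exact: leq_trans (leq_addr j i) leij.
  have ltj : j < 7 by exact: leq_trans (leq_addl i j) leij.
  have := noij (Ordinal lti); rewrite negb_exists => /forallP/(_ (Ordinal ltj)).
  by rewrite /= leij /= !negb_and !negbK.
exfalso.
have y01 := sqy 0 isT; have y12 := sqy 1 isT; have y23 := sqy 2 isT.
(* Badness at [(i, 0)] and at [(i, 1)] each prescribe the successor of [x i]. *)
have next0 i : i < 6 -> x i != y 0 -> x i != y 1 -> x i.+1 = y 0.
  move=> lti /negbTE n0 /negbTE n1; have := bad i 0; rewrite addn0 n0 n1 /=.
  by move=> /(_ (ltnW lti)) /eqP.
have next1 i : i < 6 -> x i != y 1 -> x i != y 2 -> x i.+1 = y 1.
  move=> lti /negbTE n0 /negbTE n1; have := bad i 1; rewrite addn1 n0 n1 /=.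
  by move=> /(_ lti) /eqP.
(* If [y 0 = y 2], a letter outside [y 0], [y 1] would have two successors; so [x] alternates and
   contains a square of period 2. *)
have [y02|y02] := eqVneq (y 0) (y 2).
  have two i : i < 6 -> (x i == y 0) || (x i == y 1).
    move=> lti; apply: contraT; rewrite negb_or => /andP[n0 n1].
    have := next0 _ lti n0 n1; rewrite next1 // -?y02 // => e.
    by rewrite e eqxx in y01.
  have {}two i : i < 5 -> x i = y 0 /\ x i.+1 = y 1 \/ x i = y 1 /\ x i.+1 = y 0.
    move=> lti; have := sq1 i; have := two i; have := two i.+1.
    rewrite (ltnS i.+1) lti (leq_trans lti) // => /(_ isT) e1 /(_ isT) e2 /(_ isT).
    by case/orP: e1 => /eqP->; case/orP: e2 => /eqP->; rewrite ?eqxx => // _; [right|left].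
  have ny := elimN eqP y01.
  case: (two 0 isT) (two 1 isT) (two 2 isT) => -[e0 e1] [] [e2 e3] [] [e4 e5];
    by try congruence; case: (sq2 0 isT); congruence.
(* Now [y 0] leads to [y 1], [y 2] leads to [y 0], and no fourth letter occurs. *)
have only i : i < 6 -> [\/ x i = y 0 /\ x i.+1 = y 1, x i = y 2 /\ x i.+1 = y 0
    | x i = y 1].
  move=> lti; have [e0|n0] := eqVneq (x i) (y 0).
    by apply: Or31; rewrite next1 // e0.
  have [e1|n1] := eqVneq (x i) (y 1); first exact: Or33.
  have [e2|n2] := eqVneq (x i) (y 2); first by apply: Or32; rewrite next0.
  by move: y01; rewrite -(next0 i) // -(next1 i) // eqxx.
have n01 := elimN eqP y01; have n12 := elimN eqP y12; have n02 := elimN eqP y02.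
have after1 i : i < 5 -> x i = y 1 -> [\/ x i.+1 = y 0 | x i.+1 = y 2].
  move=> lti e; have := sq1 i; rewrite e => /(_ (ltnW lti)) /eqP ne1.
  by case: (only i.+1) => // [[]|[]|]; [left|right|congruence].
case: (only 0 isT) => [[a0 b0]|[a0 b0]|a0];
case: (only 1 isT) => [[a1 b1]|[a1 b1]|a1];
  try congruence; try (by case: (after1 0 isT a0); congruence);
case: (only 2 isT) => [[a2 b2]|[a2 b2]|a2];
  try congruence; try (by case: (after1 1 isT a1); congruence);
case: (only 3 isT) => [[a3 b3]|[a3 b3]|a3];
  try congruence; try (by case: (after1 2 isT a2); congruence);
  try (by apply: (sq2 0 isT); congruence);
case: (only 4 isT) => [[a4 b4]|[a4 b4]|a4];
  try congruence; try (by case: (after1 3 isT a3); congruence);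
  try (by apply: (sq2 1 isT); congruence);
case: (only 5 isT) => [[a5 b5]|[a5 b5]|a5];
  try congruence; try (by case: (after1 4 isT a4); congruence);
  try (by apply: (sq2 2 isT); congruence);
  try (by apply: (sq2 3 isT); congruence);
  try (by apply: (sq3 0 isT); congruence).
(* The surviving prefix is y1 y0 y1 y2 y0 y1, which is good at (0, 2) or (1, 2). *)
have := bad 0 2 isT; rewrite a0 a1 (negbTE y12) (negbTE y02) orbF /= => /eqP e13.
have := bad 1 2 isT.
by rewrite a1 a2 -e13 (negbTE y01) (negbTE y02) (negbTE y12).
Qed.

(** * Long words have short s-covers *)

Section Long.
Variables (T : finType) (g : nat).
Implicit Types (s : seq T) (a b c d x y : T).
Local Notation k := #|T|.

Lemma size_undup_full s : (forall b, b \in s) -> size (undup s) = k.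
Proof.
move=> full; rewrite -(card_uniqP (undup_uniq s)); apply: eq_card => b.
by rewrite mem_undup full.
Qed.

Lemma size_firsts_full s : (forall b, b \in s) -> size (firsts s) = k.
Proof. by move=> full; rewrite size_rev size_undup_full // => b; rewrite mem_rev. Qed.

(* [x], [x'] are the first two letters of [s] and [y'], [y] the last two; the
   inequalities say that [a] is never among the outermost letters of both
   [firsts s] and [undup s], so that [size P2 + size Q1 <= 2 * k - 4]. *)
Lemma long_s_cover s x x' M M' y' y : 2 <= k -> 0 < g -> dense g s ->
  (forall b, b \in s) -> (2 * k - 2) * g <= size s ->
  s = x :: x' :: M -> s = M' ++ [:: y'; y] -> x != x' -> y' != y ->
  x != y -> x != y' -> x' != y ->
  exists C, s_cover C s /\ size C <= 2 * k.
Proof.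
move=> k2 g0 Hs full szs ex ey xx' yy' xy xy' x'y.
have Hrs := dense_rev Hs.
have szp := size_firsts_full full; have szq := size_undup_full full.
have fullr b : b \in rev s by rewrite mem_rev.
have erq : firsts (rev s) = rev (undup s) by rewrite /firsts revK.
have [d [q' eq]] : exists d q', undup s = d :: q'.
  by case: (undup s) szq => [e|d q' _]; [move: k2; rewrite -e | exists d, q'].
have [c [p' ep]] : exists c p', firsts s = rcons p' c.
  by case/lastP: (firsts s) szp => [e|p' c _]; [move: k2; rewrite -e | exists c, p'].
have erp : undup (rev s) = c :: rev p' by rewrite -[LHS]revK -/(firsts s) ep rev_rcons.
have [F [G [eF eG dG]]] := undup_consP eq.
have [F' [G' [eF' eG' cG']]] := undup_consP erp.
(* [G] misses [d], and the mirrored tail [G'] misses [c]. *)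
have szG : size G <= g by apply: (Hs (rcons F d) G [::] d); rewrite // cats0 cat_rcons.
have szG' : size G' <= g by apply: (Hrs (rcons F' c) G' [::] c); rewrite // cats0 cat_rcons.
have subG : subseq q' G by rewrite -eG undup_subseq.
have subG' : subseq (rev p') G' by rewrite -eG' undup_subseq.
have szF : size s = size F + (size G).+1 by rewrite eF size_cat.
have szF' : size s = size F' + (size G').+1 by rewrite -size_rev eF' size_cat.
have uq : uniq (d :: q') by rewrite -eq undup_uniq.
have up : uniq (rcons p' c) by rewrite -ep rev_uniq undup_uniq.
have inq a : a \in d :: q' by rewrite -eq mem_undup.
have inp a : a \in rcons p' c by rewrite -ep mem_rev mem_undup mem_rev.
have ers S1 a S2 : s = S1 ++ a :: S2 -> rev s = rev S2 ++ a :: rev S1.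
  by move=> ->; rewrite rev_cat rev_cons cat_rcons.
have [ecd|ncd] := eqVneq c d.
- subst d; exists (p' ++ c :: q'); split; last first.
    by move: szp szq; rewrite ep eq size_rcons size_cat /=; clear; lia.
  apply: s_coverP => S1 a S2 es.
  have [eac|nac] := eqVneq a c.
    subst a; exists p', q'; split=> //.
      by apply: firsts_split es _; rewrite ep -cats1.
    by apply: (undup_split (Q1 := [::]) es); rewrite eq.
  have /splitPr ap : a \in p' by have := inp a; rewrite mem_rcons inE (negbTE nac).
  have /splitPr aq : a \in q' by have := inq a; rewrite inE (negbTE nac).
  case: ap ep szp subG' up {erp eG' inp} => P1 P2 ep szp subG' up.
  case: aq eq szq subG uq {eG inq} => Q1 Q2 eq szq subG uq.
  have szS : size s = size S1 + (size S2).+1 by rewrite es size_cat.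
  have [room|noroom] := leqP (size S1 + size P2 * g) (size F).
    rewrite -catA /=; apply: (covers_left (Z := [:: c])) g0 Hs es _ eF subG _ room.
      by rewrite ep -cats1 -catA.
    apply: contraTneq up => <-; rewrite rcons_uniq mem_cat.
    by rewrite -[_ :: P2]/([:: a] ++ P2) mem_last orbT.
  (* Reversal exchanges [firsts] and [undup], so [covers_left] also handles the [a] of the second
     half. *)
  have [room'|noroom'] := leqP (size S2 + size Q1 * g) (size F').
    apply: covers_at_rev.
    have -> : rev ((P1 ++ a :: P2) ++ c :: Q1 ++ a :: Q2)
       = rev Q2 ++ a :: rev Q1 ++ c :: rev (P1 ++ a :: P2).
      by rewrite rev_cat rev_cons rev_cat rev_cons !cat_rcons -catA.
    apply: (covers_left (Z := [:: c])) g0 Hrs (ers _ _ _ es) _ eF' subG' _ _.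
    + by rewrite erq eq rev_cons rev_cat rev_cons -cats1 cat_rcons -catA.
    + apply: contraTneq uq => <-; rewrite /= mem_cat.
      have : last a (rev Q1) \in rcons Q1 a by rewrite -mem_rev rev_rcons mem_last.
      by rewrite mem_rcons !inE => /orP[->|->]; rewrite ?orbT.
    + by rewrite !size_rev.
  have : size s < (2 * k - 2) * g.
    apply: (no_room (A := size P2) (B := size Q1) k2 szS szF szF') => //.
    (* [P2] misses [a] and [c], and [Q1] misses [a] and [d], so each has at most [k - 2] letters. *)
    by move: szp szq; rewrite ep eq size_rcons /= !size_cat /=; clear; lia.
  by rewrite ltnNge szs.
- exists (rcons p' c ++ d :: q'); split; last first.
    by move: szp szq; rewrite ep eq size_cat; clear; lia.
  apply: s_coverP => S1 a S2 es.
  have szS : size s = size S1 + (size S2).+1 by rewrite es size_cat.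
  have [P1 [P2 eP]] : exists P1 P2, rcons p' c = P1 ++ a :: P2.
    by case/splitPr: (inp a) => P1 P2; exists P1, P2.
  have [Q1 [Q2 eQ]] : exists Q1 Q2, d :: q' = Q1 ++ a :: Q2.
    by case/splitPr: (inq a) => Q1 Q2; exists Q1, Q2.
  have lastP2 : last a P2 = c.
    by rewrite -(last_rcons a p' c) eP last_cat.
  have lastQ1 : last a (rev Q1) = d.
    have : last a (rev (d :: q')) = d by rewrite rev_cons last_rcons.
    by rewrite eQ rev_cat rev_cons last_cat last_rcons.
  have [room|noroom] := leqP (size S1 + size P2 * g) (size F).
    rewrite eP -catA /=; apply: (covers_left (Z := [::])) g0 Hs es _ eF subG _ room.
      by rewrite cats0 ep.
    by rewrite lastP2.
  have [room'|noroom'] := leqP (size S2 + size Q1 * g) (size F').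
    apply: covers_at_rev.
    have -> : rev (rcons p' c ++ d :: q')
       = rev Q2 ++ a :: rev Q1 ++ c :: rev p'.
      by rewrite rev_cat eQ rev_cat rev_cons rev_rcons cat_rcons -catA.
    apply: (covers_left (Z := [::])) g0 Hrs (ers _ _ _ es) _ eF' subG' _ _.
    + by rewrite erq eq eQ rev_cat rev_cons cat_rcons cats0.
    + by rewrite lastQ1 eq_sym.
    + by rewrite !size_rev.
  have : size s < (2 * k - 2) * g.
    apply: (no_room (A := size P2) (B := size Q1) k2 szS szF szF') => //.
    have szP : size P1 + (size P2).+1 = k by rewrite -szp ep eP size_cat.
    have szQ : size Q1 + (size Q2).+1 = k by rewrite -szq eq eQ size_cat.
    have [Qy Qy'] : (size Q2 = 0 -> a = y) /\ (size Q2 = 1 -> a = y').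
      by apply: (undup_end (s := M') (Q1 := Q1)); rewrite // -ey eq.
    have [Px Px'] : (size P1 = 0 -> a = x) /\ (size P1 = 1 -> a = x').
      rewrite -!(size_rev P1).
      apply: (undup_end (s := rev M) (Q1 := rev P2)); first by rewrite eq_sym.
      rewrite -[[:: x'; x]]/(rev [:: x; x']) -rev_cat /= -ex erp.
      by rewrite -rev_rcons eP rev_cat rev_cons cat_rcons.
    (* The remaining cases identify [a] with end letters on both sides, forcing [x = y], [x = y'] or
       [x' = y]. *)
    suff : 2 <= size P1 + size Q2 by move: szP szQ; clear; lia.
    case: (size P1) Px Px' => [|[|m]] Px Px'; last by [].
      case: (size Q2) Qy Qy' => [|[|m']] Qy Qy' //.
        by move: xy; rewrite -Px // -Qy // eqxx.
      by move: xy'; rewrite -Px // -Qy' // eqxx.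
    case: (size Q2) Qy Qy' => [|m'] Qy Qy'; last by rewrite add1n.
    by move: x'y; rewrite -Px' // -Qy // eqxx.
  by rewrite ltnNge szs.
Qed.

Lemma s_primitive_dense s : (forall s b, s_primitive s -> b \notin s -> size s <= g) ->
  s_primitive s -> dense g s.
Proof.
move=> Hg prim A B D b es; apply: Hg.
by move: prim; rewrite es => /s_primitive_factor.
Qed.

Lemma s_primitive_bound s : 4 <= k ->
  (forall s b, s_primitive s -> b \notin s -> size s <= g) ->
  s_primitive s -> size s <= (2 * k - 2) * g + 6.
Proof.
move=> k4 Hg prim; rewrite leqNgt; apply/negP => szs.
have [z _] : exists z : T, True 
  by case: (pickP T) => [z _|/eq_card0 e]; [exists z | move: k4; rewrite e].
set N := (2 * k - 2) * g in szs *.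
have leN : 6 * g <= N by rewrite leq_mul2r; apply/orP; right; lia.
(* A prefix of length [g + 1] contains all letters. This yields [2 * k <= 6 * g <= N], so the cover
   found below is shorter than the word. *)
have kg : k <= g.+1.
  have szt : size (take g.+1 s) = g.+1 by rewrite size_takel //; lia.
  rewrite -[X in _ <= X]szt -(size_undup_full (s := take g.+1 s)) ?size_undup // => b.
  apply: contraT => /(s_primitive_dense Hg prim (A := [::]) (D := drop g.+1 s)).
  by rewrite szt ltnn cat_take_drop => /(_ erefl).
pose n := size s; pose x i := nth z s i; pose y j := nth z s (n - j.+1).
have n11 : 11 <= n by rewrite /n; lia.
have adj i : i.+1 < n -> x i != x i.+1.
  move=> lti; apply/eqP => e.
  apply: (s_primitive_nth_square (z := z) (l := 1) (i := i) prim) => //.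
    by rewrite -/n; lia.
  by case=> // _; rewrite !addn0 addn1.
have [i [j [leij xy xy' x'y]]] : exists i j,
    [/\ i + j <= 6, x i != y j, x i != y j.+1 & x i.+1 != y j].
  apply: good_ends => [i lti|i lti e1 e2|i lti e1 e2 e3|j ltj].
  - by apply: adj; lia.
  - apply: (s_primitive_nth_square (z := z) (l := 2) (i := i) prim) => //.
      by rewrite -/n; lia.
    by case=> [|[|//]] _; rewrite ?addn0 ?addn1 ?addn2 ?addn3.
  - apply: (s_primitive_nth_square (z := z) (l := 3) (i := i) prim) => //.
      by rewrite -/n; lia.
    by case=> [|[|[|//]]] _; rewrite ?addn0 ?addn1 ?addn2 ?addn3 ?addSn.
  - rewrite eq_sym; have -> : y j = x (n - j.+2).+1 by rewrite /x /y; congr nth; lia.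
    by apply: adj; lia.
(* Deleting [i + j <= 6] end letters leaves more than [N] letters, whence the [+ 6] in the bound. *)
pose t := take (n - i - j) (drop i s).
have szt : size t = n - i - j by rewrite size_takel // size_drop -/n; lia.
have xt m : m < n - i - j -> nth z t m = x (i + m) by move=> ltm; rewrite nth_take // nth_drop.
have primt : s_primitive t.
  apply: (@s_primitive_factor _ (take i s) t (drop (n - i - j) (drop i s))).
  by rewrite !cat_take_drop.
have sztg : N < size t by rewrite szt /n; lia.
have et0 : t = x i :: x i.+1 :: drop 2 t.
  rewrite -[LHS]drop0 (drop_nth z) ?(drop_nth z (n := 1)) ?xt ?szt ?addn0 ?addn1 //; lia.
have et1 : t = take (size t - 2) t ++ [:: y j.+1; y j].
  have [le1 le2] : size t - 2 < size t /\ (size t - 2).+1 < size t by lia.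
  rewrite -{1}(cat_take_drop (size t - 2) t) (drop_nth z le1) (drop_nth z le2).
  rewrite [drop _.+2 t]drop_oversize; last by lia.
  rewrite !xt -?szt // szt; congr (_ ++ [:: _; _]); rewrite /x /y; congr nth; lia.
case: (@long_s_cover t _ _ _ _ _ _ _ _ _ _ _ et0 et1) => //.
- by lia.
- by lia.
- exact: s_primitive_dense.
- move=> b; apply: contraT => /(Hg t b primt); lia.
- exact: ltnW.
- by apply: adj; lia.
- have -> : y j = x (n - j.+2).+1 by rewrite /x /y; congr nth; lia.
  by apply: adj; lia.
- move=> C [covC szC]; apply: primt; exists C; split=> //.
  apply: leq_ltn_trans (leq_trans szC (leq_trans _ leN)) sztg.
  by move: k4 kg; clear; lia.
Qed.
End Long.

(** * Change of alphabet and existence of [gamma] *)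

Lemma s_primitive_map (T U : eqType) (f : T -> U) (s : seq T) : injective f ->
  s_primitive (map f s) <-> s_primitive s.
Proof.
move=> inj_f; split=> prim [C [covC szC]]; apply: prim.
- exists (map f C); rewrite !size_map; split=> // i; rewrite size_map => lti.
  have [m [szm eC mi]] := covC i lti.
  by exists m; rewrite -map_mask eC.
- case: s covC szC => // a s covC szC.
  have [|m [szm eC _]] := covC 0; first by rewrite size_map.
  exists (mask m (a :: s)); split; last first.
    by move: szC; rewrite -eC -map_mask !size_map.
  move=> i lti; have [|m' [szm' eC' mi]] := covC i; first by rewrite size_map.
  exists m'; rewrite szm' size_map; split=> //.
  by apply: (inj_map inj_f); rewrite !map_mask eC eC'.
Qed.

Lemma lift_mapP n (b : 'I_n.+1) (s : seq 'I_n.+1) :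
  b \notin s -> exists s', s = map (lift b) s'.
Proof.
elim: s => [|a s IH]; first by exists [::].
rewrite inE negb_or => /andP[ba /IH[s' ->]].
by have [a' -> _] := unlift_some ba; exists (a' :: s').
Qed.

Lemma gamma_spec_exists k M :
  (forall S : seq 'I_k, s_primitive S -> size S <= M) -> exists g, gamma_spec k g.
Proof.
move=> bnd.
pose P n : bool :=
  excluded_middle_informative (exists S : seq 'I_k, s_primitive S /\ size S = n).
have PP n : reflect (exists S : seq 'I_k, s_primitive S /\ size S = n) (P n).
  by rewrite /P; case: excluded_middle_informative => H /=; constructor.
have exP : exists n, P n.
  by exists 0; apply/PP; exists [::]; split=> //; exact: s_primitive_nil.
have leP n : P n -> n <= M by move/PP=> [S [prim <-]]; exact: bnd.
have [g /PP Pg maxg] := ex_maxnP exP leP.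
by exists g; split=> // S prim; apply: maxg; apply/PP; exists S.
Qed.

Lemma gammaP k : (exists g, gamma_spec k g) -> gamma_spec k (gamma k).
Proof.
rewrite /gamma; case: excluded_middle_informative => // H _.
exact: proj2_sig.
Qed.

Theorem mainTheorem1 (k : nat) (hk : 4 <= k) :
  gamma k <= (2 * k - 2) * gamma (k - 1) + 6.
Proof.
have [exk|nexk] := excluded_middle_informative (exists g, gamma_spec k g); last first.
  by rewrite {1}/gamma; case: excluded_middle_informative.
have [[S [primS <-]] maxk] := gammaP exk.
case: k hk exk S primS maxk => // k hk exk S primS maxk; rewrite subn1 /=.
have [_ maxk1] : gamma_spec k (gamma k).
  apply: gammaP; apply: (@gamma_spec_exists _ (size S)) => s prim.
  rewrite -(size_map (lift ord0)); apply: maxk.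
  by apply/s_primitive_map => //; exact: lift_inj.
have := @s_primitive_bound 'I_k.+1 (gamma k) S; rewrite card_ord; apply=> // s b prims bs.
have [s' es] := lift_mapP bs; rewrite es size_map; apply: maxk1.
by apply/(s_primitive_map _ (@lift_inj _ b)); rewrite -es.
Qed.
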